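(* For every integer $n\ge 1$: (a) for every $d\ge 1$, $f(n,d)=n$; (b) for every $d\ge 1$, $f(n,d,2)=n+\lceil n/d\rceil$; (c) for every $d\ge 3$ there is a constant $C_d$ depending only on $d$ such that $\left|f(n,d,3)-\left(1+\frac{2}{d-1}\right)n\right|\le C_d$ for all $n\ge 1$.
   Context: For integers $d\ge 1$, $n\ge 1$, $T_d(n)=\{(x_1,\dots,x_d)\in\mathbb{Z}_{\ge 0}^d : x_1+\dots+x_d\le n-1\}$. A $k$-cover of $T_d(n)$ is a finite multiset of affine hyperplanes in $\mathbb{R}^d$ such that every point of $T_d(n)$ lies in at least $k$ of them (with multiplicity). $f(n,d,k)$ is the minimum cardinality of a $k$-cover of $T_d(n)$, and $f(n,d)=f(n,d,1)$. *)

(* Defs.v *)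
From HB Require Import structures.
From mathcomp Require Import all_boot all_order all_algebra.
From mathcomp Require Import reals.
Set Implicit Arguments. Unset Strict Implicit. Unset Printing Implicit Defensive.
Import Order.TTheory GRing.Theory Num.Theory.
Local Open Scope ring_scope.

(* An affine hyperplane {x in R^d | a . x = b}, given by (a, b) with a <> 0. *)
Definition hyperplane (R : realType) (d : nat) : Type := ('rV[R]_d * R)%type.

Definition is_hyperplane (R : realType) (d : nat) (H : hyperplane R d) : Prop :=
  H.1 != 0.

Definition on_hyp (R : realType) (d : nat) (H : hyperplane R d)
  (p : 'I_d -> nat) : bool :=
  \sum_(i < d) H.1 ord0 i * (p i)%:R == H.2.

Definition in_T (n d : nat) (p : 'I_d -> nat) : Prop :=
  (\sum_(i < d) p i <= n.-1)%N.

Definition k_cover (R : realType) (n d k : nat) (s : seq (hyperplane R d)) : Prop :=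
  (forall H, H \in s -> is_hyperplane H) /\
  (forall p : 'I_d -> nat, @in_T n d p -> (k <= count (fun H => on_hyp H p) s)%N).

Definition is_f (R : realType) (n d k m : nat) : Prop :=
  (exists s, @k_cover R n d k s /\ size s = m) /\
  (forall s, @k_cover R n d k s -> (m <= size s)%N).

(* Main.v *)
Require Import Defs.
From HB Require Import structures.
From mathcomp Require Import all_boot all_order all_algebra.
From mathcomp Require Import reals boolp.
From mathcomp Require Import zify ring lra.
Import Order.TTheory GRing.Theory Num.Theory.
Local Open Scope ring_scope.

(* With the slack coordinate x_0 = n - 1 - (x_1 + ... + x_d), T_d(n) becomes a
   simplex with d + 1 interchangeable facets x_i = 0. Upper bounds come from
   the layers x_i = c with c below roughly n / (d + 2 - k), for each i.

   Lower bounds are by induction on d. Let a be the least c such that the layer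
   x_i = c is not a plane of the k-cover. The other planes that are not parallel
   to facet i cut that layer in a k-cover of T_{d-1}(n - a), so a small a gives
   the bound; if a is large for every i, then the d + 1 disjoint classes of
   parallel planes are already numerous enough.

   For k = 3 the induction starts at d = 3, with 2n <= m + 1 for a 3-cover of
   size m. Choose o minimizing the number of layers x_o = c in the cover minus
   the number of those that occur twice, and look at the fibers x_o = c, x_j = c'
   that are contained in at most one plane. Such a fiber is a segment of
   n - c - c' points, each needing two more planes, and every other plane meets
   it in at most one point. The planes that contain some of these fibers without
   being parallel to a facet are the "tilted" ones, affine lines in the
   (x_o, x_j)-plane. Two well-chosen fibers, one at the first free column and
   one at the first free place of the lowest row, give two inequalities: a
   tilted line through a point of the lowest row between the two columns passes
   below that row at one of them, hence is useless there, and this gain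
   compensates the tilted planes in the sum of the two inequalities. *)

(** * Double counting of planes *)

(** Exchanging the sums, each [F] is hit by at most one [v] in [W], hence counted at most once. *)
Lemma sum_count_le (T : Type) (s : seq T) (W : seq nat) (hit : nat -> pred T)
    (P : pred T) :
  uniq W ->
  (forall F v w, v \in W -> w \in W -> hit v F -> hit w F -> v = w) ->
  (forall F v, v \in W -> hit v F -> P F) ->
  (\sum_(v <- W) count (hit v) s <= count P s)%N.
Proof.
move=> uW inj sub.
under eq_bigr do rewrite -sum1_count big_mkcond.
rewrite exchange_big -sum1_count [leqRHS]big_mkcond /=; apply: leq_sum => F _.
have [/hasP [v vW hv]|/hasPn no] := boolP (has (fun v => hit v F) W); last first.
  by rewrite big_seq big1 // => v /no /negbTE ->.
rewrite (sub F v vW hv) (bigD1_seq v) //= hv big_seq_cond big1 //.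
move=> w /andP [wW]; apply: contraNeq; case: ifP => // hw _.
by rewrite (inj F w v wW vW hw hv).
Qed.

Lemma size_le_count (T : Type) (s : seq T) (W : seq nat) (hit : nat -> pred T)
    (P : pred T) :
  uniq W ->
  (forall F v w, v \in W -> w \in W -> hit v F -> hit w F -> v = w) ->
  (forall F v, v \in W -> hit v F -> P F) ->
  (forall v, v \in W -> 0 < count (hit v) s)%N ->
  (size W <= count P s)%N.
Proof.
move=> uW inj sub pos; apply: leq_trans (sum_count_le _ _ _ _ _ uW inj sub).
by rewrite -sum1_size big_seq [leqRHS]big_seq; apply: leq_sum.
Qed.

Lemma sum_count_le_size (T : Type) (I : finType) (B : {set I})
    (P : I -> pred T) (s : seq T) :
  (forall F i j, i \in B -> j \in B -> P i F -> P j F -> i = j) ->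
  (\sum_(i in B) count (P i) s <= count (fun F => [exists i in B, P i F]) s)%N.
Proof.
move=> inj; under eq_bigr do rewrite -sum1_count big_mkcond.
rewrite exchange_big -sum1_count [leqRHS]big_mkcond /=; apply: leq_sum => F _.
case: ifP => [/exists_inP [i iB hi]|/exists_inPn no].
  rewrite (bigD1 i) //= hi big1 ?addn0 // => j /andP [jB].
  by apply: contraNeq; case: ifP => // hj _; rewrite (inj F j i).
by rewrite big1 // => j jB; rewrite ifN // no.
Qed.

(** * Affine forms on a simplex and its facets *)

(** Restricting to a layer shrinks a subset [A] of the fixed index type [I], so the induction on
    dimension stays within one type. *)
Definition affine (R : realFieldType) (I : finType) : Type :=
  ({ffun I -> R} * R)%type.

Section Forms.
Context {R : realFieldType} {I : finType}.
Implicit Types (A B C : {set I}) (F : affine R I) (p q : I -> nat) (i j r : I).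

Definition on F p := \sum_i F.1 i * (p i)%:R == F.2.

(** Where the coordinates in [A] have a fixed sum and the others are frozen, such a form is
    constant; the negation says that it cuts out a proper hyperplane of that simplex. *)
Definition cst A F := [forall i in A, forall j in A, F.1 i == F.1 j].

Lemma cstP A F : reflect {in A &, forall i j, F.1 i = F.1 j} (cst A F).
Proof.
apply: (iffP forall_inP) => [h i j iA jA|h i iA].
  by have /forall_inP/(_ j jA)/eqP := h i iA.
by apply/forall_inP => j jA; apply/eqP/h.
Qed.

Lemma cst_sub A B F : A \subset B -> cst B F -> cst A F.
Proof. by move=> /subsetP sAB /cstP h; apply/cstP => i j /sAB iB /sAB; apply: h. Qed.

Lemma cst_glue A B C F r :
  r \in B -> r \in C -> A \subset B :|: C -> cst B F -> cst C F -> cst A F.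
Proof.
move=> rB rC /subsetP sA /cstP hB /cstP hC.
have e x : x \in A -> F.1 x = F.1 r.
  by move/sA; rewrite inE => /orP [xB|xC]; [apply: hB | apply: hC].
by apply/cstP => i j /e -> /e ->.
Qed.

Definition pt A q (N : nat) p : Prop :=
  (forall i, i \notin A -> p i = q i) /\ (\sum_(i in A) p i = N)%N.

Definition covers A q (N k : nat) (s : seq (affine R I)) : Prop :=
  all (fun F => ~~ cst A F) s /\
  (forall p, pt A q N p -> (k <= count (on^~ p) s)%N).

Definition cval B F : R := if [pick r in B] is Some r then F.1 r else 0.

Lemma cvalE B F r : r \in B -> cst B F -> F.1 r = cval B F.
Proof.
move=> rB /cstP h; rewrite /cval; case: pickP => [x xB|/(_ r)]; last by rewrite rB.
exact: h.
Qed.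

(* For a form constant on [A :\: B], membership of a point only depends on its
   coordinates in [B]; [rhs] is the right-hand side after elimination. *)
Definition rhs A B q (N : nat) F : R :=
  F.2 - \sum_(i | i \notin A) F.1 i * (q i)%:R - cval (A :\: B) F * N%:R.

Lemma on_red A B q N F p :
  B \subset A -> cst (A :\: B) F -> pt A q N p ->
  on F p = (\sum_(i in B) (F.1 i - cval (A :\: B) F) * (p i)%:R == rhs A B q N F).
Proof.
move=> sBA cF [pq pN]; rewrite /on /rhs.
rewrite (bigID (fun i => i \in A)) /= -[N in RHS]pN.
rewrite (eq_bigr (fun i => F.1 i * (q i)%:R)
  (P := fun i => i \notin A)); last by move=> i iA; rewrite pq.
have -> : \sum_(i in A) F.1 i * (p i)%:R =
   \sum_(i in B) (F.1 i - cval (A :\: B) F) * (p i)%:R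
   + cval (A :\: B) F * (\sum_(i in A) p i)%:R.
  rewrite natr_sum mulr_sumr (big_setID B) [X in _ = _ + X](big_setID B) /= (setIidPr sBA).
  rewrite (eq_bigr (fun i => cval (A :\: B) F * (p i)%:R)
     (P := fun i => i \in A :\: B)); last first.
    by move=> i iAB; rewrite (cvalE _ _ i iAB cF).
  rewrite addrA -big_split; congr (_ + _).
  by apply: eq_bigr => i _ /=; ring.
by rewrite -[RHS]subr_eq0 -[LHS]subr_eq0; congr (_ == 0); ring.
Qed.

(* [cls A i]: the forms parallel to the facet [x_i = 0]; [lay A q N i c]: those
   that vanish on the layer [x_i = c]. *)
Definition cls A i F := cst (A :\ i) F && ~~ cst A F.
Definition lay A q N i (c : nat) F :=
  cls A i F && ((F.1 i - cval (A :\ i) F) * c%:R == rhs A [set i] q N F).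

Lemma on_lay A q N i F p :
  i \in A -> cls A i F -> pt A q N p -> on F p = lay A q N i (p i) F.
Proof.
move=> iA /[dup] cF /andP [ci _] hp.
by rewrite (on_red A [set i] q N) ?sub1set // big_set1 /lay cF.
Qed.

Lemma cls_neq A i F : i \in A -> cls A i F -> F.1 i != cval (A :\ i) F.
Proof.
move=> iA /andP [ci]; apply: contra => /eqP e.
have h x : x \in A -> F.1 x = cval (A :\ i) F.
  move=> xA; case: (eqVneq x i) => [-> //|xi].
  by apply: cvalE => //; rewrite !inE xi.
by apply/cstP => x y /h -> /h ->.
Qed.

Lemma lay_inj A q N i F c c' :
  i \in A -> lay A q N i c F -> lay A q N i c' F -> c = c'.
Proof.
move=> iA /andP [cF /eqP e] /andP [_ /eqP e'].
have := cls_neq _ _ _ iA cF; rewrite -subr_eq0 => /mulfI h.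
by apply/eqP; rewrite -(eqr_nat R); apply/eqP/h; rewrite e e'.
Qed.

(** A third index of [A] lies in both [A :\ i] and [A :\ j], so a form constant on both is constant
    on [A]. *)
Lemma cls_inj A i j F : (2 < #|A|)%N -> i \in A -> j \in A ->
  cls A i F -> cls A j F -> i = j.
Proof.
move=> cA iA jA /andP [ci nF] /andP [cj _]; apply/eqP; apply: contraNT nF => ij.
have /card_gt0P [r] : (0 < #|A :\ i :\ j|)%N.
  have := cardsD1 i A; have := cardsD1 j (A :\ i).
  by rewrite iA !inE (eq_sym j) ij jA /=; lia.
rewrite !inE => /and3P [rj ri rA].
apply: (cst_glue _ (A :\ i) (A :\ j) F r) => //; rewrite ?inE ?rj ?ri //.
apply/subsetP => x xA; rewrite !inE xA !andbT.
by case: eqVneq => //= ->; rewrite ij.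
Qed.

Definition upd q i (c : nat) j := if j == i then c else q j.

Lemma pt_upd A q N i c p : i \in A -> (c <= N)%N ->
  pt (A :\ i) (upd q i c) (N - c) p -> pt A q N p /\ p i = c.
Proof.
move=> iA cN [pq ps].
have pi : p i = c by rewrite pq ?inE ?eqxx // /upd eqxx.
split=> //; split=> [j jA|].
  rewrite pq ?inE ?negb_and ?jA ?orbT // /upd; case: eqVneq jA => // ->.
  by rewrite iA.
by rewrite (big_setD1 i) //= ps pi subnKC.
Qed.

(** On a layer, a form of class [i] vanishes everywhere or nowhere. No form contains this layer, so
    those dropped cover none of its points. *)
Lemma covers_restrict A q N k s i c : i \in A -> (c <= N)%N ->
  covers A q N k s -> count (lay A q N i c) s = 0%N ->
  covers (A :\ i) (upd q i c) (N - c) k (filter (fun F => ~~ cst (A :\ i) F) s).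
Proof.
move=> iA cN [ncs cov] lay0; split; first exact: filter_all.
move=> p /pt_upd -/(_ iA cN) [hp pc]; have := cov p hp.
rewrite count_filter => /leq_trans; apply.
have e : {in s, (on^~ p) =1 predU (predI (on^~ p) (fun F => ~~ cst (A :\ i) F))
             (lay A q N i c)}.
  move=> F Fs /=; have nF := allP ncs F Fs.
  case: (boolP (cst (A :\ i) F)) => cF.
    by rewrite andbF (on_lay A q N i) ?pc // /cls cF nF.
  by rewrite andbT /lay /cls (negbTE cF) orbF.
by rewrite (eq_in_count e) -[leqRHS]addn0 -lay0 -count_predUI leq_addr.
Qed.

Lemma count_cls_split A q N k s i : i \in A -> covers A q N k s ->
  (count (cls A i) s + size (filter (fun F => ~~ cst (A :\ i) F) s) = size s)%N.
Proof.
move=> iA [/allP ncs _]; rewrite size_filter -(count_predC (cst (A :\ i)) s).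
congr (_ + _)%N; apply: eq_in_count => F Fs.
by rewrite /cls ncs // andbT.
Qed.

Lemma layers_le_cls A q N s i c : i \in A ->
  (forall c', c' < c -> 0 < count (lay A q N i c') s)%N ->
  (c <= count (cls A i) s)%N.
Proof.
move=> iA h; rewrite -[c in (c <= _)%N](size_iota 0).
apply: (size_le_count _ _ _ (lay A q N i)); first exact: iota_uniq.
- by move=> F v w _ _; apply: lay_inj.
- by move=> F v _ /andP [].
- by move=> v; rewrite mem_iota => /andP [_ /h].
Qed.

(** On a segment every form of the cover belongs to class [i], and so contains at most one of the
    [N.+1] points. *)
Lemma covers_edge A q N k s : #|A| = 2%N -> covers A q N k s ->
  (k * N.+1 <= size s)%N.
Proof.
move=> /eqP/cards2P [i [j [ij eA]]] cov.
have iA : i \in A by rewrite eA !inE eqxx.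
have jA : j \in A by rewrite eA !inE eqxx orbT.
have cF F : cst (A :\ i) F.
  by apply/cstP => x y; rewrite eA !inE => /andP [/negbTE -> /eqP ->] /andP [/negbTE -> /eqP ->].
have lec c : (c < N.+1)%N -> (k <= count (lay A q N i c) s)%N.
  move=> cN; pose p x := if x == i then c else if x == j then (N - c)%N else q x.
  have hp : pt A q N p.
    split=> [x|]; first by rewrite /p eA !inE negb_or => /andP [/negbTE -> /negbTE ->].
    by rewrite eA big_setU1 ?big_set1 ?inE //= /p eqxx eq_sym (negbTE ij) eqxx; lia.
  case: cov => /allP ncs /(_ p hp); rewrite (eq_in_count (a2 := lay A q N i c)) //.
  move=> F Fs; rewrite (on_lay A q N i) /cls ?cF ?ncs //.
  by rewrite /p eqxx.
apply: (@leq_trans (\sum_(c <- iota 0 N.+1) count (lay A q N i c) s)%N).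
  rewrite -[N.+1 in leqLHS](size_iota 0) -sum1_size big_distrr big_seq [leqRHS]big_seq.
  by apply: leq_sum => c; rewrite mem_iota => /andP [_ /lec]; rewrite /= muln1.
apply: leq_trans (count_size predT s); apply: sum_count_le => //; first exact: iota_uniq.
by move=> F v w _ _; apply: lay_inj.
Qed.

End Forms.

(** * The induction on the dimension *)

Section LowerBound.
Context {R : realFieldType} {I : finType}.
Implicit Types (A B C : {set I}) (F : affine R I) (p q : I -> nat) (i j r : I).

(** A uniform shape for the three values of [k], used with [e = d + 2 - k], so that [e] grows by one
    with [d]. *)
Definition lower_bound (d k e kappa : nat) : Prop :=
  forall A q N (s : seq (affine R I)), #|A| = d.+1 -> covers A q N k s ->
  (d.+1 * N.+1 <= e * (size s + kappa))%N.

Lemma lower_bound_edge k e kappa : (2 <= e * k)%N -> lower_bound 1 k e kappa.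
Proof.
move=> ek A q N s cA /covers_edge -/(_ cA) h.
have := leq_mul ek (leqnn N.+1); have := leq_mul (leqnn e) h; nia.
Qed.

(* Either every class contains all its layers up to [(N + 1) / (e + 1)], or
   one restricts the cover to the first missing layer. *)
Lemma lower_bound_step d k e kappa : (0 < d)%N -> (0 < e)%N -> (e <= d.+1)%N ->
  lower_bound d k e kappa -> lower_bound d.+1 k e.+1 kappa.
Proof.
move=> d0 e0 ed IH A q N s cA cov.
(* [B] is the least integer with [e.+1 * B > N.+1], so [e.+1 * c <= N.+1] for each [c < B]. *)
set B := (N.+1 %/ e.+1).+1.
have [/existsP [i /andP [iA /existsP [c /andP [/eqP c0 /forallP hc]]]]|no] :=
  boolP [exists i, (i \in A) && [exists c : 'I_B,
    (count (lay A q N i c) s == 0%N) &&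
    [forall c' : 'I_B, (c' < c)%N ==> (0 < count (lay A q N i c') s)%N]]].
- have ce : (e.+1 * c <= N.+1)%N.
    have := ltn_ord c; have := leq_trunc_div N.+1 e.+1; rewrite /B; nia.
  have cN : (c <= N)%N by nia.
  have cM : (c <= count (cls A i) s)%N.
    apply: (layers_le_cls A q N) => // c' c'c.
    have c'B := ltn_trans c'c (ltn_ord c).
    by have := hc (Ordinal c'B); rewrite /= c'c.
  have cAi : #|A :\ i| = d.+1 by have := cardsD1 i A; rewrite iA cA => -[].
  have := IH _ _ _ _ cAi (covers_restrict _ _ _ _ _ _ _ iA cN cov c0).
  have := count_cls_split _ _ _ _ _ _ iA cov.
  set m := size (filter _ _); set M := count _ s => <- h.
  have {}h : (d.+1 * (N.+1 - c) <= e * (m + kappa))%N by rewrite subSn.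
  have hM : (e * c <= e * M)%N by rewrite leq_mul2l cM orbT.
  have h1 : (e * (d.+2 * N.+1) <= e * (e.+1 * (c + m + kappa)))%N.
    have h2 : (e.+1 * (d.+1 * (N.+1 - c)) <= e.+1 * (e * (m + kappa)))%N.
      by rewrite leq_mul2l h orbT.
    (* Given [h2] and [hM], [h1] reduces to this inequality, where the choice of [B] enters. *)
    have h3 : ((d.+1 - e) * (e.+1 * c) <= (d.+1 - e) * N.+1)%N.
      by rewrite leq_mul2l ce orbT.
    have [D eD] : exists D, d.+1 = (e + D)%N by exists (d.+1 - e)%N; lia.
    have [X eX] : exists X, N.+1 = (c + X)%N by exists (N.+1 - c)%N; lia.
    move: h2 h3; rewrite (_ : d.+2 = (e + D).+1)%N ?eD ?eX; last by rewrite -eD.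
    by rewrite !addKn; nia.
  rewrite leq_pmul2l // in h1; apply: leq_trans h1 _.
  by rewrite leq_mul2l; apply/orP; right; lia.
have hB i : i \in A -> (B <= count (cls A i) s)%N.
  move=> iA; apply: (layers_le_cls A q N) => //.
  move=> c; have [n] := ubnP c; elim: n c => // n IHn c /ltnSE cn cB.
  rewrite lt0n; apply/negP => /eqP c0; case/negP: no.
  apply/existsP; exists i; rewrite iA; apply/existsP; exists (Ordinal cB) => /=.
  rewrite c0 eqxx; apply/forallP => c'; apply/implyP => c'c.
  exact: IHn (leq_trans c'c cn) _.
have h1 : (d.+2 * B <= size s)%N.
  apply: leq_trans (count_size (fun F => [exists i in A, cls A i F]) s).
  apply: leq_trans (sum_count_le_size _ _ A (cls A) s _).
    by rewrite -cA -sum_nat_const; apply: leq_sum.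
  by move=> F i j; apply: cls_inj; rewrite cA.
have h2 : (N.+1 < e.+1 * B)%N by have := ltn_ceil N.+1 (ltn0Sn e); rewrite /B mulnC.
have h3 : (e.+1 * (d.+2 * B) <= e.+1 * size s)%N by rewrite leq_mul2l h1 orbT.
nia.
Qed.

End LowerBound.
Lemma count_disjoint (T : Type) (P Q S : pred T) (s : seq T) :
  (forall F, P F -> ~~ Q F) -> (forall F, P F || Q F -> S F) ->
  (count P s + count Q s <= count S s)%N.
Proof.
move=> PQ PQS; elim: s => //= F s IH; rewrite addnACA leq_add //.
move: (PQ F) (PQS F); case: (P F); case: (Q F) => //= h1 h2; rewrite ?h2 //.
by have := h1 isT.
Qed.

Lemma count_iota_le (P : pred nat) (m n : nat) :
  (m <= n)%N -> (count P (iota 0 m) <= count P (iota 0 n))%N.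
Proof. by move=> /subnKC <-; rewrite iotaD count_cat leq_addr. Qed.

Lemma count_predU_le (T : Type) (P Q : pred T) (s : seq T) :
  (count (predU P Q) s <= count P s + count Q s)%N.
Proof. by rewrite -count_predUI leq_addr. Qed.

(** * Tilted planes and fibers of a tetrahedron *)

Section Tetrahedron.
Context {R : realFieldType} {I : finType}.
Variables (A : {set I}) (q : I -> nat) (N : nat) (s : seq (affine R I)).
Variable (o : I).
Hypotheses (cA : #|A| = 4%N) (cov : covers A q N 3 s) (oA : o \in A).
Implicit Types (F : affine R I) (p : I -> nat) (i j k : I) (c y : nat).

(* Forms depending on [x_o] and [x_k] only, and parallel to no facet. *)
Definition tilted k F :=
  [&& cst (A :\: [set o; k]) F, ~~ cst (A :\ o) F & ~~ cst (A :\ k) F].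

(* A tilted form is a line in the [(x_o, x_k)]-plane; [height k c F] is its
   ordinate at [x_o = c]. *)
Definition height k c F : R :=
  (rhs A [set o; k] q N F - (F.1 o - cval (A :\: [set o; k]) F) * c%:R)
    / (F.1 k - cval (A :\: [set o; k]) F).

Definition meets k c y F := tilted k F && (height k c F == y%:R).
Definition below k c y F := tilted k F && (height k c F < y%:R).

Lemma tilted_neq k F : k \in A :\ o -> tilted k F ->
  (F.1 o != cval (A :\: [set o; k]) F) /\ (F.1 k != cval (A :\: [set o; k]) F).
Proof.
rewrite !inE => /andP [ko kA] /and3P [c0 no nk]; split.
  apply: contraNneq nk => e.
  have h x : x \in A :\ k -> F.1 x = cval (A :\: [set o; k]) F.
    rewrite !inE => /andP [xk xA]; case: (eqVneq x o) => [-> //|xo].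
    by apply: cvalE => //; rewrite !inE negb_or xk xo.
  by apply/cstP => x y /h -> /h ->.
apply: contraNneq no => e.
have h x : x \in A :\ o -> F.1 x = cval (A :\: [set o; k]) F.
  rewrite !inE => /andP [xo xA]; case: (eqVneq x k) => [-> //|xk].
  by apply: cvalE => //; rewrite !inE negb_or xk xo.
by apply/cstP => x y /h -> /h ->.
Qed.

Lemma on_tilted k F p : k \in A :\ o -> tilted k F -> pt A q N p ->
  on F p = (height k (p o) F == (p k)%:R).
Proof.
move=> kA tF hp; have [_ w0] := tilted_neq _ _ kA tF.
move: tF kA => /andP [cF _]; rewrite !inE => /andP [ko kA].
rewrite (on_red A [set o; k] q N) //; last first.
  by apply/subsetP => x; rewrite !inE => /orP [] /eqP ->.
rewrite big_setU1 ?big_set1 ?inE 1?eq_sym //=.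
move: w0; rewrite -subr_eq0 /height => w0.
rewrite -subr_eq0 -[RHS]subr_eq0 -[RHS](inj_eq (mulfI w0)) mulr0 mulrBr.
rewrite [X in _ = (X - _ == 0)]mulrC divfK //.
by congr (_ == 0); ring.
Qed.

Lemma meets_inj_height k c F y y' : meets k c y F -> meets k c y' F -> y = y'.
Proof.
by move=> /andP [_ /eqP e] /andP [_ /eqP e']; apply/eqP; rewrite -(eqr_nat R) -e e'.
Qed.

Lemma meets_inj_col k c c' F y : k \in A :\ o ->
  meets k c y F -> meets k c' y F -> c = c'.
Proof.
move=> kA /andP [tF /eqP e] /andP [_ /eqP]; have [u0 w0] := tilted_neq _ _ kA tF.
rewrite -{}e /height; move: u0 w0; rewrite -subr_eq0 => u0; rewrite -subr_eq0 => w0.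
move/(mulIf (invr_neq0 w0))/addrI/oppr_inj/(mulfI u0)/eqP.
by rewrite eqr_nat => /eqP.
Qed.

(* The height is strictly monotone, so that it decreases on one side. *)
Lemma meets_below k c0 c c1 y F : k \in A :\ o -> (c0 < c < c1)%N ->
  meets k c y F -> below k c0 y F || below k c1 y F.
Proof.
move=> kA /andP [c0c cc1] /andP [tF /eqP e].
have [u0 w0] := tilted_neq _ _ kA tF.
rewrite /below tF /= -{}e /height; move: u0 w0; rewrite -subr_eq0 => u0; rewrite -subr_eq0 => w0.
move: u0 w0; move: (rhs _ _ _ _ _) (F.1 o - _) (F.1 k - _) => K u w u0 w0.
rewrite !mulrBl !ltrD2l !ltrN2 -!mulrA ![_%:R / w]mulrC !mulrA.
have v0 : u / w != 0 by rewrite mulf_neq0 ?invr_neq0.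
have [v|v|/eqP] := ltrgtP (u / w) 0; last by rewrite (negbTE v0).
  by rewrite !(ltr_nM2l v) !ltr_nat c0c.
by rewrite !(ltr_pM2l v) !ltr_nat cc1 orbT.
Qed.

(** A coordinate outside [o], [j], [k] is the overlap at which the next four lemmas glue. *)
Lemma fourth j k : exists2 r, r \in A & [&& r != o, r != j & r != k].
Proof.
have /card_gt0P [r] : (0 < #|A :\ o :\ j :\ k|)%N.
  have := cardsD1 o A; have := cardsD1 j (A :\ o); have := cardsD1 k (A :\ o :\ j).
  by rewrite cA; do 3![case: (_ \in _)] => /=; lia.
by rewrite !inE => /and4P [rk rj ro rA]; exists r => //; rewrite ro rj rk.
Qed.

Lemma tilted_inj j k F : j \in A :\ o -> k \in A :\ o ->
  tilted j F -> tilted k F -> j = k.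
Proof.
move=> jA kA /and3P [cj no _] /and3P [ck _ _]; apply/eqP; apply: contraNT no => jk.
have [r rA /and3P [ro rj rk]] := fourth j k.
apply: (cst_glue _ _ _ _ r _ _ _ cj ck); rewrite ?inE ?negb_or ?ro ?rj ?rk //.
apply/subsetP => x; rewrite !inE !negb_or => /andP [-> ->] /=.
by rewrite !andbT; case: eqVneq => //= ->.
Qed.

Lemma tilted_ncst j k F : j \in A :\ o -> k \in A :\: [set o; j] ->
  tilted k F -> ~~ cst (A :\: [set o; j]) F.
Proof.
move=> jA kD /and3P [ck no _]; apply: contra no => cj.
have [r rA /and3P [ro rj rk]] := fourth j k.
apply: (cst_glue _ _ _ _ r _ _ _ cj ck); rewrite ?inE ?negb_or ?ro ?rj ?rk //.
apply/subsetP => x; rewrite !inE !negb_or => /andP [-> ->] /=.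
rewrite !andbT; case: (eqVneq x j) => //= ->.
by move: kD; rewrite !inE negb_or => /andP [/andP [_]]; rewrite eq_sym.
Qed.

Lemma cls_ncst j k F : j \in A :\ o -> k \in A :\: [set o; j] ->
  cls A k F -> ~~ cst (A :\: [set o; j]) F.
Proof.
move=> jA kD /andP [ck nA]; apply: contra nA => cj.
have [r rA /and3P [ro rj rk]] := fourth j k.
apply: (cst_glue _ _ _ _ r _ _ _ cj ck); rewrite ?inE ?negb_or ?ro ?rj ?rk //.
apply/subsetP => x; rewrite !inE !negb_or => -> /=.
rewrite !andbT; case: (eqVneq x k) => [->|]; rewrite ?orbT //.
by move: kD; rewrite !inE negb_or => /andP [->].
Qed.

Lemma cls_ntilted j k F : j \in A :\ o -> k \in A :\ o -> cls A j F -> ~~ tilted k F.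
Proof.
move=> jA kA /andP [cj nA]; apply/negP => /and3P [ck no nk].
have [ejk|jk] := eqVneq j k; first by rewrite -ejk cj in nk.
have [r rA /and3P [ro rj rk]] := fourth j k.
case/negP: nA; apply: (cst_glue _ _ _ _ r _ _ _ cj ck); rewrite ?inE ?negb_or ?ro ?rj ?rk //.
apply/subsetP => x; rewrite !inE !negb_or => -> /=.
rewrite !andbT; case: (eqVneq x j) => //= ->.
by move: jA; rewrite !inE => /andP [-> _].
Qed.

Lemma fiber_bound (y : I -> nat) j c0 c1 : j \in A :\ o ->
  (forall k v, k \in A :\: [set o; j] -> (v < y k)%N ->
     (1 < count (lay A q N k v) s)%N) ->
  ((c0 + c1 <= N)%N -> [/\ count (lay A q N o c0) s = 0%N,
     (count (lay A q N j c1) s <= 1)%N & count (meets j c0 c1) s = 0%N]) ->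
  (2 * N.+1 + count (cls A o) s + count (cls A j) s + count (tilted j) s
   + \sum_(k in A :\: [set o; j]) count (below k c0 (y k)) s
   <= size s + 2 * (c0 + c1))%N.
Proof.
move=> jAo hy hc; have jA : j \in A by move: jAo; rewrite inE => /andP [].
have jo : j != o by move: jAo; rewrite !inE => /andP [].
set D := A :\: [set o; j].
have DE : D = A :\ o :\ j by rewrite setDDl.
have Do k : k \in D -> k \in A :\ o by rewrite DE inE => /andP [].
have DA k : k \in D -> k \in A by rewrite inE => /andP [].
have cD : #|D| = 2%N.
  have := cardsD1 o A; have := cardsD1 j (A :\ o).
  by rewrite jAo oA cA -DE /=; lia.
pose E F := [exists k in D, below k c0 (y k) F].
pose s' := filter (fun F => ~~ cst D F && ~~ E F) s.
have [ncs cover] := cov.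
have nEcls k F : k \in D -> cls A k F -> ~~ cst D F && ~~ E F.
  move=> kD ck; rewrite (cls_ncst j k) //=; apply/exists_inPn => k' k'D.
  by rewrite negb_and (cls_ntilted k) ?Do.
have h1 : (count (cls A o) s + count (cls A j) s + count (tilted j) s
   + \sum_(k in D) count (below k c0 (y k)) s + size s' <= size s)%N.
  have oj F : cls A o F -> ~~ cls A j F.
    move=> co; apply: contra_neqN jo => cj; apply/esym.
    by apply: (cls_inj A _ _ F) => //; rewrite cA.
  have subD F : cls A o F || cls A j F -> cst D F.
    case/orP => /andP [+ _]; apply: cst_sub; apply/subsetP => x;
    by rewrite !inE negb_or => /andP [/andP [xo xj] ->]; rewrite ?xo ?xj.
  have := count_disjoint _ _ _ (fun F => cls A o F || cls A j F) s oj (fun _ => id).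
  have : (count (fun F => cls A o F || cls A j F) s + count (tilted j) s
          <= count (cst D) s)%N.
    apply: count_disjoint => F; last by case/orP => [/subD //|/and3P []].
    case/orP => [/andP [c _]|c]; first by rewrite /tilted c andbF.
    exact: (cls_ntilted j).
  have : (\sum_(k in D) count (below k c0 (y k)) s <= count E s)%N.
    apply: sum_count_le_size => F i k iD kD /andP [ti _] /andP [tk _].
    by apply: (tilted_inj _ _ F); rewrite ?Do.
  have : (count (cst D) s + count E s <= count (fun F => cst D F || E F) s)%N.
    apply: count_disjoint => // F cF; apply/exists_inPn => k kD.
    by apply/negP => /andP [/tilted_ncst] -/(_ j jAo kD); rewrite -/D cF.
  have : (count (fun F => cst D F || E F) s + size s' = size s)%N.
    rewrite size_filter -(count_predC (fun F => cst D F || E F) s).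
    by congr addn; apply: eq_count => F /=; rewrite negb_or.
  lia.
(* Beyond [N] the fiber is empty and [h1] suffices. *)
have [cN|] := leqP (c0 + c1)%N N; last by lia.
have [o0 j1 m0] := hc cN.
have := @covers_edge R I D (upd (upd q o c0) j c1) (N - c0 - c1) 2 s' cD.
suff cov' : covers D (upd (upd q o c0) j c1) (N - c0 - c1) 2 s' by move/(_ cov'); lia.
split.
  by apply/allP => F; rewrite mem_filter => /andP [/andP []].
have c0N : (c0 <= N)%N by lia.
have c1N : (c1 <= N - c0)%N by lia.
move=> p; rewrite DE => /pt_upd -/(_ jAo c1N) [/pt_upd -/(_ oA c0N) [hp po] pj].
have on_s' (P : pred (affine R I)) : (forall F, P F -> on F p && (~~ cst D F && ~~ E F)) ->
    (count P s <= count (on^~ p) s')%N.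
  by move=> h; rewrite count_filter; apply: sub_count.
have [/hasP [F Fs /andP [oF /exists_inP [k kD /andP [tF hF]]]]|noE] :=
    boolP (has (fun F => on F p && E F) s).
  have lt : (p k < y k)%N.
    rewrite -po in hF; move: oF hF; rewrite (on_tilted k) ?Do // => /eqP ->.
    by rewrite ltr_nat.
  apply: leq_trans (hy k _ kD lt) (on_s' _ _) => F' /[dup] /andP [ck _].
  by rewrite -(on_lay A q N) ?DA // (nEcls k) // => ->.
have le3 := cover p hp.
have sub : {in s, subpred (on^~ p) (predU (predU (lay A q N o c0) (lay A q N j c1))
    (predU (meets j c0 c1) (predI (on^~ p) (fun F => ~~ cst D F && ~~ E F))))}.
  move=> F Fs /= oF; have nF := allP ncs F Fs.
  have := hasPn noE F Fs; rewrite oF /= => ->; rewrite andbT.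
  case: (boolP (cst D F)) => [cF|_]; last by rewrite !orbT.
  case: (boolP (cls A o F)) => [co|nco].
    by move: oF; rewrite (on_lay A q N o) // po => ->.
  case: (boolP (cls A j F)) => [cj|ncj].
    by move: oF; rewrite (on_lay A q N j) // pj => ->; rewrite orbT.
  have tF : tilted j F.
    by move: nco ncj; rewrite /cls /tilted nF !andbT => -> ->; rewrite cF.
  by move: oF; rewrite /meets tF (on_tilted j) // po pj => ->; rewrite !orbT.
rewrite count_filter.
have cU P Q := count_predU_le (affine R I) P Q s.
have := cU (lay A q N o c0) (lay A q N j c1).
have := cU (meets j c0 c1) (predI (on^~ p) (fun F => ~~ cst D F && ~~ E F)).
have := cU (predU (lay A q N o c0) (lay A q N j c1))
   (predU (meets j c0 c1) (predI (on^~ p) (fun F => ~~ cst D F && ~~ E F))).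
have : (count (on^~ p) s <= count (predU (predU (lay A q N o c0) (lay A q N j c1))
    (predU (meets j c0 c1) (predI (on^~ p) (fun F => ~~ cst D F && ~~ E F)))) s)%N.
  rewrite (eq_in_count (a1 := on^~ p) (a2 := predI (on^~ p)
    (predU (predU (lay A q N o c0) (lay A q N j c1))
    (predU (meets j c0 c1) (predI (on^~ p) (fun F => ~~ cst D F && ~~ E F)))))).
    by apply: sub_count => F /= /andP [].
  move=> F Fs; case oF : (on F p); rewrite /= oF //.
  by apply/esym; have := sub F Fs oF; rewrite /= oF.
lia.
Qed.

End Tetrahedron.

(** * Three-covers of the tetrahedron: choice of two fibers *)

(** Equals [n] if no index below [n] satisfies [P]; as a coordinate of a fiber, this default makes
    the fiber empty. *)
Definition first (P : pred nat) (n : nat) : nat := find P (iota 0 n).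

Lemma first_le P n : (first P n <= n)%N.
Proof. by rewrite -[leqRHS](size_iota 0) find_size. Qed.

Lemma first_true P n : (first P n < n)%N -> P (first P n).
Proof.
move=> lt; have hs : has P (iota 0 n) by rewrite has_find size_iota.
by have := nth_find 0%N hs; rewrite nth_iota.
Qed.

Lemma first_before P n c : (c < first P n)%N -> ~~ P c.
Proof.
move=> lt; have := before_find 0%N lt.
by rewrite nth_iota ?add0n => [->|] //; apply: leq_trans lt (first_le P n).
Qed.

Lemma leq_count_predC (P : pred nat) (m n : nat) : (m <= n)%N ->
  (m <= count (predC P) (iota 0 n) + count P (iota 0 m))%N.
Proof.
move=> mn; rewrite -[m in (m <= _)%N](size_iota 0) -(count_predC P) addnC.
by rewrite leq_add2r count_iota_le.
Qed.

Lemma lower_bound_tetrahedron (R : realFieldType) (I : finType) :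
  @lower_bound R I 3 3 2 1.
Proof.
move=> A q N s cA cov; set n := N.+1.
pose mu i c := count (lay A q N i c) s.
pose L m i := count (fun c => m <= mu i c)%N (iota 0 n).
have LM i : i \in A -> (L 1%N i + L 2%N i <= count (cls A i) s)%N.
  move=> iA; apply: (@leq_trans (\sum_(c <- iota 0 n) mu i c)%N); last first.
    apply: sum_count_le; first exact: iota_uniq.
      by move=> F v w _ _; apply: lay_inj.
    by move=> F v _ /andP [].
  rewrite /L -!sum1_count big_mkcond [X in (_ + X)%N]big_mkcond -big_split.
  by apply: leq_sum => c _ /=; case: (mu i c) => [|[]].
have Ln m i : (L m i <= n)%N by rewrite -[leqRHS](size_iota 0) count_size.
have [o oA omin] : exists2 o, o \in A &
    forall j, j \in A -> (L 1%N o + L 2%N j <= L 1%N j + L 2%N o)%N.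
  have /card_gt0P [x xA] : (0 < #|A|)%N by rewrite cA.
  (* This minimizes [L 1 i - L 2 i], shifted by [n] to avoid truncated subtraction. *)
  have [o oA ho] := @arg_minnP _ x (mem A) (fun i => L 1%N i + (n - L 2%N i))%N xA.
  exists o => // j jA. by move: (Ln 2%N o) (Ln 2%N j) (ho j jA); lia.
(* The two fibers will be [(col j, y j)] and [(a, c1)], in the coordinates [(x_o, x_j)]. *)
pose a := first (fun c => mu o c == 0)%N n.
pose y k := first (fun v => mu k v <= 1)%N n.
pose col k := first (fun c => (mu o c == 0) &&
  (count (meets A q N o k c (y k)) s == 0))%N n.
have [j jAo jmin] : exists2 j, j \in A :\ o &
    forall k, k \in A :\ o -> (col j <= col k)%N.
  have /card_gt0P [x xA] : (0 < #|A :\ o|)%N by have := cardsD1 o A; rewrite oA cA; lia.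
  have [j jA hj] := @arg_minnP _ x (mem (A :\ o)) col xA.
  by exists j.
have jA : j \in A by move: jAo; rewrite inE => /andP [].
pose c1 := first (fun v => (mu j v <= 1) &&
  (count (meets A q N o j a v) s == 0))%N n.
(* [t] and [h] count the places before [col j] and [c1] that only tilted planes block. *)
pose t := count (fun c => mu o c == 0)%N (iota 0 (col j)).
pose h := count (fun v => mu j v <= 1)%N (iota 0 c1).
have a_le : (a <= L 1%N o)%N.
  have := leq_count_predC (fun c => mu o c == 0)%N a n (first_le _ _).
  rewrite (eq_in_count (a2 := pred0) (s := iota 0 a)) ?count_pred0 ?addn0.
    by move/leq_trans; apply; apply: sub_count => c /=; rewrite lt0n.
  by move=> c; rewrite mem_iota => /andP [_ /first_before /negbTE].
have col_le : (col j <= L 1%N o + t)%N.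
  have := leq_count_predC (fun c => mu o c == 0)%N (col j) n (first_le _ _).
  by move/leq_trans; apply; rewrite leq_add2r; apply: sub_count => c /=; rewrite lt0n.
have y_le : (y j <= L 2%N j)%N.
  have := leq_count_predC (fun v => mu j v <= 1)%N (y j) n (first_le _ _).
  rewrite (eq_in_count (a2 := pred0) (s := iota 0 (y j))) ?count_pred0 ?addn0.
    by move/leq_trans; apply; apply: sub_count => c /=; rewrite -ltnNge.
  by move=> c; rewrite mem_iota => /andP [_ /first_before /negbTE].
have c1_le : (c1 <= L 2%N j + h)%N.
  have := leq_count_predC (fun v => mu j v <= 1)%N c1 n (first_le _ _).
  by move/leq_trans; apply; rewrite leq_add2r; apply: sub_count => c /=; rewrite -ltnNge.
have h_le : (h <= count (tilted A o j) s)%N.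
  rewrite /h -size_filter; apply: (size_le_count _ _ _ (meets A q N o j a)).
  - by rewrite filter_uniq // iota_uniq.
  - by move=> F v w _ _; apply: meets_inj_height.
  - by move=> F v _ /andP [].
  - move=> v; rewrite mem_filter mem_iota => /andP [mv /andP [_ /first_before]].
    by rewrite mv /= lt0n.
(* A tilted plane blocks each of these columns at height [y k], and [meets_below] puts it below that
   row at [a] or at [col j]. Column [a] itself is lost, hence [t.-1]. *)
have t_le k : k \in A :\ o -> (t.-1 <= count (below A q N o k a (y k)) s
    + count (below A q N o k (col j) (y k)) s)%N.
  move=> kA; pose W := [seq c <- iota 0 (col j) | (mu o c == 0)%N && (a < c)%N].
  have tW : (t <= 1 + size W)%N.
    rewrite size_filter; apply: (@leq_trans (count (predU (pred1 a)
        (fun c => (mu o c == 0)%N && (a < c)%N)) (iota 0 (col j)))).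
      apply: sub_count => c /= m0; rewrite m0 /=; case: ltngtP => // ca.
      by have := first_before _ _ _ ca; rewrite m0.
    apply: leq_trans (count_predU_le _ _ _ _) _.
    rewrite leq_add2r count_uniq_mem ?iota_uniq //.
    exact: leq_b1.
  have : (size W <= count (fun F => below A q N o k a (y k) F
      || below A q N o k (col j) (y k) F) s)%N.
    apply: (size_le_count _ _ _ (fun c => meets A q N o k c (y k))).
    - by rewrite filter_uniq // iota_uniq.
    - by move=> F v w _ _; exact: (meets_inj_col A q N o k v w F (y k) kA).
    - move=> F c; rewrite mem_filter mem_iota => /andP [/andP [_ ac] /andP [_ cc]].
      by apply: meets_below => //; rewrite ac.
    - move=> c; rewrite mem_filter mem_iota => /andP [/andP [m0 _] /andP [_ cc]].
      (* By minimality of [col j], column [c] precedes [col k] too, so a tilted plane of [k] blocks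
         it. *)
      have := first_before _ _ _ (leq_trans cc (jmin k kA)).
      by rewrite m0 /= lt0n.
  move=> hW; apply: leq_trans (leq_trans hW (count_predU_le _ (below A q N o k a (y k))
    (below A q N o k (col j) (y k)) s)); lia.
have hy k v : k \in A :\: [set o; j] -> (v < y k)%N -> (1 < mu k v)%N.
  by move=> _ /first_before; rewrite ltnNge.
have fib c0 c' := fiber_bound A q N s o cA cov oA y j c0 c' jAo hy.
have h1 : (2 * n + count (cls A o) s + count (cls A j) s + count (tilted A o j) s
    + \sum_(k in A :\: [set o; j]) count (below A q N o k (col j) (y k)) s
    <= size s + 2 * (col j + y j))%N.
  apply: fib => le.
  have /first_true/andP [/eqP m0 /eqP e0] : (col j < n)%N by rewrite /n; lia.
  by split=> //; apply: (first_true (fun v => mu j v <= 1)%N n); rewrite -/(y j) /n; lia.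
have h2 : (2 * n + count (cls A o) s + count (cls A j) s + count (tilted A o j) s
    + \sum_(k in A :\: [set o; j]) count (below A q N o k a (y k)) s
    <= size s + 2 * (a + c1))%N.
  apply: fib => le.
  have /first_true/andP [m1 /eqP e1] : (c1 < n)%N by rewrite /n; lia.
  split=> //; apply/eqP.
  by apply: (first_true (fun c => mu o c == 0)%N n); rewrite -/a /n; lia.
have hD : (2 * t.-1 <= \sum_(k in A :\: [set o; j]) count (below A q N o k a (y k)) s
    + \sum_(k in A :\: [set o; j]) count (below A q N o k (col j) (y k)) s)%N.
  have <- : #|A :\: [set o; j]| = 2%N.
    have := cardsD1 o A; have := cardsD1 j (A :\ o).
    by rewrite setDDl jAo oA cA /=; lia.
  rewrite -sum_nat_const -big_split /=; apply: leq_sum => k.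
  by rewrite -setDDl inE => /andP [_]; apply: t_le.
(* In the sum of [h1] and [h2], the tilted planes of [j] absorb [h], the two directions in [hD]
   absorb [t] up to one column, and [omin] settles the remaining layer counts. The lost column gives
   [kappa = 1]. *)
move: (LM o oA) (LM j jA) (omin j jA) h1 h2 hD a_le col_le y_le c1_le h_le; lia.
Qed.

Lemma lower_bound1 (R : realFieldType) (I : finType) d :
  (0 < d)%N -> @lower_bound R I d 1 d.+1 0.
Proof.
case: d => // d _; elim: d => [|d IH]; first exact: lower_bound_edge.
exact: lower_bound_step.
Qed.

Lemma lower_bound2 (R : realFieldType) (I : finType) d :
  (0 < d)%N -> @lower_bound R I d 2 d 0.
Proof.
case: d => // d _; elim: d => [|d IH]; first exact: lower_bound_edge.
exact: lower_bound_step.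
Qed.

Lemma lower_bound3 (R : realFieldType) (I : finType) d :
  (2 < d)%N -> @lower_bound R I d 3 d.-1 1.
Proof.
case: d => [|[|[|d]]] // _; elim: d => [|d IH]; first exact: lower_bound_tetrahedron.
by apply: lower_bound_step => //=; lia.
Qed.

(** * From hyperplanes to forms in simplex coordinates *)

(* The coordinate [ord0] is the slack [n - 1 - (x_1 + ... + x_d)]. *)
Definition homogenize (R : realType) (d : nat) (H : hyperplane R d) :
    affine R 'I_d.+1 :=
  ([ffun i => if unlift ord0 i is Some j then H.1 ord0 j else 0], H.2).

Lemma on_homogenize (R : realType) (d : nat) (H : hyperplane R d)
    (p : 'I_d.+1 -> nat) :
  on (homogenize R d H) p = on_hyp H (fun j => p (lift ord0 j)).
Proof.
rewrite /on /on_hyp big_ord_recl /= ffunE unlift_none mul0r add0r.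
by congr (_ == _); apply: eq_bigr => j _; rewrite ffunE liftK.
Qed.

Lemma covers_homogenize (R : realType) (n d k : nat) (s : seq (hyperplane R d)) :
  k_cover n k s ->
  covers [set: 'I_d.+1] (fun=> 0%N) n.-1 k (map (homogenize R d) s).
Proof.
move=> [hs cov]; split.
  (* The slack coefficient is 0, so a form constant on all indices has zero normal. *)
  apply/allP => _ /mapP [H Hs ->]; apply: contra (hs H Hs) => /cstP c.
  apply/eqP/rowP => j; rewrite mxE; have := c (lift ord0 j) ord0 (in_setT _) (in_setT _).
  by rewrite !ffunE liftK unlift_none.
move=> p [_ pN]; rewrite count_map.
have inT : in_T n (fun j => p (lift ord0 j)).
  by rewrite /in_T -pN (eq_bigl xpredT) ?big_ord_recl ?leq_addl // => i; rewrite inE.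
by apply: leq_trans (cov _ inT) _; apply: sub_count => H /=; rewrite on_homogenize.
Qed.

Lemma k_cover_size (R : realType) (n d k e kappa : nat) (s : seq (hyperplane R d)) :
  (0 < n)%N -> @lower_bound R 'I_d.+1 d k e kappa -> k_cover n k s ->
  (d.+1 * n <= e * (size s + kappa))%N.
Proof.
move=> n0 lb /covers_homogenize /lb; rewrite size_map prednK //; apply.
by rewrite cardsT card_ord.
Qed.

(** * Upper bounds from layers *)

(** For [ord0], the slack layer [x_0 = c] is the plane x_1 + ... + x_d = n - 1 - c. *)
Definition layer (R : realType) (n d : nat) (i : 'I_d.+1) (c : nat) :
    hyperplane R d :=
  if unlift ord0 i is Some j then (delta_mx ord0 j, c%:R)
  else (const_mx 1, n.-1%:R - c%:R).

Lemma sum_minn (S q m : nat) :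
  (\sum_(i < m) minn q (S - i * q) = minn S (m * q))%N.
Proof. by elim: m => [|m IH]; rewrite ?big_ord0 ?big_ord_recr /= ?IH; lia. Qed.

(* Fill the [d + 1] facet directions greedily, [q] layers each, with
   [n + k q] layers in all. A point in at most [k] of them would have
   coordinate sum at least [n]. *)
Lemma layers_cover (R : realType) (n d k q : nat) : (0 < n)%N -> (0 < d)%N ->
  (n + k * q <= d.+1 * q)%N ->
  exists s : seq (hyperplane R d), k_cover n k.+1 s /\ size s = (n + k * q)%N.
Proof.
move=> n0 d0; set S := (n + k * q)%N => Sq.
pose w (i : 'I_d.+1) := minn q (S - i * q).
have wS : (\sum_i w i = S)%N by rewrite sum_minn; apply/minn_idPl.
pose s := flatten [seq [seq layer R n d i c | c <- iota 0 (w i)] | i <- index_enum 'I_d.+1].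
exists s; split; last first.
  rewrite size_flatten sumnE /shape !big_map. rewrite -wS.
  by apply: eq_bigr => i _; rewrite size_map size_iota.
split=> [H /flattenP [_ /mapP [i _ ->] /mapP [c _ ->]]|p inT].
  rewrite /is_hyperplane /layer; case: unlift => [j|] /=.
    apply/eqP => /rowP /(_ j); rewrite !mxE !eqxx => /eqP.
    by rewrite oner_eq0.
  apply/eqP => /rowP /(_ (Ordinal d0)); rewrite !mxE => /eqP.
  by rewrite oner_eq0.
pose x i := if unlift ord0 i is Some j then p j else (n.-1 - \sum_j p j)%N.
have xS : (\sum_i x i = n.-1)%N.
  rewrite big_ord_recl {1}/x unlift_none.
  have -> : (\sum_j x (lift ord0 j) = \sum_j p j)%N.
    by apply: eq_bigr => j _; rewrite /x liftK.
  exact: subnK.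
have on_x i : on_hyp (layer R n d i (x i)) p.
  rewrite /on_hyp /layer /x; case: unlift => [j|] /=.
    rewrite (bigD1 j) //= mxE !eqxx mul1r big1 ?addr0 // => l lj.
    by rewrite mxE (negbTE lj) andbF mul0r.
  under eq_bigr do rewrite mxE mul1r.
  by rewrite -natr_sum natrB // opprB addrC subrK.
pose g := (\sum_i (x i < w i)%N)%N.
apply: (@leq_trans g); last first.
  rewrite count_flatten sumnE !big_map; apply: leq_sum => i _.
  case: ltnP => // lt; rewrite -has_count; apply/hasP; exists (layer R n d i (x i)) => //.
  by apply/mapP; exists (x i); rewrite ?mem_iota.
(* A direction contributes at most [q] if the layer of [p] is present; otherwise [w i <= x i], and
   the [x i] sum to [n.-1]. *)
have : (S <= q * g + n.-1)%N.
  rewrite -wS -xS big_distrr -big_split /=; apply: leq_sum => i _.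
  by case: ltnP => h; rewrite ?muln1 ?muln0 //; apply: leq_trans (geq_minl _ _) (leq_addr _ _).
by rewrite /S ltnNge => h; apply/negP => gk; have := leq_mul (leqnn q) gk; lia.
Qed.

(** Supplies the minimum in part (c), which names no exact value. *)
Lemma is_f_exists (R : realType) (n d k : nat) (s0 : seq (hyperplane R d)) :
  k_cover n k s0 -> exists2 s, @k_cover R n d k s & is_f R n d k (size s).
Proof.
move=> cov0; pose P m := `[< exists2 s : seq (hyperplane R d), k_cover n k s & size s = m >].
have exP : exists m, P m by exists (size s0); apply/asboolP; exists s0.
case: (ex_minnP exP) => m /asboolP [s cov sm] min; exists s => //.
split; first by exists s.
by move=> s' cov'; rewrite sm; apply: min; apply/asboolP; exists s'.
Qed.

Theorem mainTheorem6 (R : realType) :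
  (forall n d : nat, (1 <= n)%N -> (1 <= d)%N -> is_f R n d 1 n) /\
  (forall n d : nat, (1 <= n)%N -> (1 <= d)%N ->
     is_f R n d 2 (n + (n + d.-1) %/ d)%N) /\
  (forall d : nat, (3 <= d)%N ->
     exists C : R, forall n : nat, (1 <= n)%N ->
       exists m : nat, is_f R n d 3 m /\
         `| m%:R - (1 + 2 / (d.-1)%:R) * n%:R | <= C).
Proof.
split; [|split].
- move=> n d n0 d0; split.
    by have := layers_cover R n d 0 n n0 d0; rewrite mul0n addn0 leq_pmull //; apply.
  move=> s /(k_cover_size _ _ _ _ _ _ _ n0 (lower_bound1 _ _ _ d0)).
  by rewrite addn0 leq_pmul2l.
- move=> n d n0 d0; set q := (_ %/ d)%N.
  have nq : (n <= d * q)%N.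
    by have := ltn_ceil (n + d.-1) d0; rewrite -/q; lia.
  split.
    have := layers_cover R n d 1 q n0 d0; rewrite mul1n; apply; lia.
  move=> s /(k_cover_size _ _ _ _ _ _ _ n0 (lower_bound2 _ _ _ d0)).
  rewrite addn0 => h.
  have := leq_trunc_div (n + d.-1) d; rewrite -/q; nia.
(* The deviation is at least -1, by [kappa], and at most 2, from rounding up in [q]; so 2 serves
   every [d]. *)
- move=> d d3; exists 2 => n n0; pose e := d.-1; have e0 : (0 < e)%N by rewrite /e; lia.
  have eR : (0 : R) < e%:R by rewrite ltr0n.
  pose q := ((n + e.-1) %/ e)%N.
  have nq : (n <= e * q)%N.
    by have := ltn_ceil (n + e.-1) e0; rewrite -/q; lia.
  have qn : (e * q <= n + e.-1)%N by rewrite mulnC leq_trunc_div.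
  have [||s0 [cov0 s0E]] := layers_cover R n d 2 q n0; [lia | by rewrite /e in nq; nia |].
  have [s cov f] := is_f_exists _ _ _ _ _ cov0; exists (size s); split=> //.
  have lo := k_cover_size _ _ _ _ _ _ _ n0 (lower_bound3 _ _ _ d3) cov.
  have hi : (size s <= n + 2 * q)%N by rewrite -s0E; case: f => _; apply.
  have {}lo : ((e + 2) * n <= e * (size s + 1))%N.
    by rewrite (_ : e + 2 = d.+1)%N //; rewrite /e; lia.
  have {}hi : (e * size s <= (e + 2) * n + 2 * e)%N by nia.
  rewrite -/e; move: lo hi; rewrite -!(ler_nat R) !(natrM, natrD) => lo hi.
  rewrite -(ler_pM2l eR) -{1}(gtr0_norm eR) -normrM.
  have -> : e%:R * ((size s)%:R - (1 + 2 / e%:R) * n%:R) =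
      e%:R * (size s)%:R - (e%:R + 2) * n%:R :> R.
    by field; rewrite gt_eqF.
  by rewrite ler_norml; apply/andP; split; lra.
Qed.
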